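(* Let $\tau>0$ and $\nu>0$. Assume the distributions of a real random variable $t$ under the null and alternative hypotheses are described by $$H_0:\ t\sim T(\nu,0),\qquad\qquad H_1:\ t\mid\lambda\sim T(\nu,\lambda),\quad \lambda\mid\tau^2\sim J(0,\tau^2).$$ Then, for every $t\in\mathbb{R}$, the Bayes factor in favor of the alternative hypothesis is $$BF_{10}(t\mid\tau^2)=(\tau^2+1)^{-3/2}\left(\frac{r}{s}\right)^{\frac{\nu+1}{2}}\left(1+\frac{qt^2}{s}\right),$$ where $$r=1+\frac{t^2}{\nu},\qquad s=1+\frac{t^2}{\nu(1+\tau^2)},\qquad q=\frac{\tau^2(\nu+1)}{\nu(1+\tau^2)}.$$
   Context: $T(\nu,\lambda)$ denotes the (non-central) $t$ distribution with $\nu$ degrees of freedom and non-centrality parameter $\lambda\in\mathbb{R}$, i.e. the distribution of $(Z+\lambda)/\sqrt{W/\nu}$ with $Z\sim N(0,1)$ and $W\sim\chi^2_\nu$ independent. $J(\mu_0,\tau^2)$ (with $\tau>0$) denotes the normal moment distribution on $\mathbb{R}$, with density $$j(x\mid\mu_0,\tau^2)=\frac{(x-\mu_0)^2}{\sqrt{2\pi}\,\tau^3}\exp\left(-\frac{(x-\mu_0)^2}{2\tau^2}\right).$$ The hyperparameter $\tau^2$ is a fixed constant. The Bayes factor in favor of the alternative hypothesis based on a test statistic $x$ is $BF_{10}(x\mid\tau^2)=m_1(x\mid\tau^2)/m_0(x)$, where $m_0(x)$ is the density of the statistic under $H_0$, and $m_1(x\mid\tau^2)=\int f(x\mid\lambda)\,\pi(\lambda\mid\tau^2)\,d\lambda$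 is its marginal density under $H_1$. Here $f(x\mid\lambda)$ is the density of the statistic given $\lambda$ under $H_1$ and $\pi(\lambda\mid\tau^2)$ is the prior density of $\lambda$ under $H_1$. *)

(* Defs.v *)
From HB Require Import structures.
From mathcomp Require Import all_boot all_order all_algebra.
From mathcomp Require Import all_classical all_reals all_analysis.
From mathcomp Require Import measurable_realfun ring lra.

Set Implicit Arguments.
Unset Strict Implicit.
Unset Printing Implicit Defensive.

Import Order.TTheory GRing.Theory Num.Theory.
Import numFieldNormedType.Exports.

Local Open Scope classical_set_scope.
Local Open Scope ring_scope.

Section gamma.
Context {R : realType}.
Implicit Types a x : R.
Notation mu := (@lebesgue_measure R).

Definition gamma_fun a x : R := x `^ (a - 1) * expR (- x).

Definition Gamma a : R := \int[mu]_(x in `]0, +oo[) gamma_fun a x.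

Lemma gamma_fun_ge0 a x : 0 <= gamma_fun a x.
Proof. by rewrite mulr_ge0 ?powR_ge0 ?expR_ge0. Qed.

Lemma measurable_gamma_fun a : measurable_fun setT (gamma_fun a).
Proof.
apply: measurable_funM; first exact: measurable_powR.
by apply: measurableT_comp => //; exact: measurable_oppr.
Qed.

Lemma continuous_gamma_fun a x : 0 < x -> {for x, continuous (gamma_fun a)}.
Proof.
move=> x0; have dp : derivable (fun x : R => x `^ (a - 1) : R^o) x 1.
  by apply: derivable_powR; rewrite in_itv/= x0.
apply: (@continuousM _ R^o (fun x => x `^ (a - 1)) (fun x => expR (- x))).
  by apply: differentiable_continuous; apply/derivable1_diffP.
apply: continuous_comp; last exact: continuous_expR.
exact: (@continuousN _ R^o R^o id).
Qed.

Lemma itv0y_bigcup (c : R) : 0 < c ->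
  `]0, +oo[%classic = \bigcup_n `[c * n.+1%:R^-1, +oo[%classic.
Proof.
move=> c0; apply/seteqP; split=> x /=; rewrite in_itv/= andbT.
  move=> x0; have xc : 0 < x / c by rewrite divr_gt0.
  have [n _ nx] := near_infty_natSinv_lt (PosNum xc).
  exists n => //=; rewrite in_itv/= andbT ltW// mulrC -ltr_pdivlMr//.
  exact: (nx n (leqnn n)).
move=> [n _] /=; rewrite in_itv/= andbT; apply: lt_le_trans.
by rewrite mulr_gt0.
Qed.

Lemma cvg_itv0y (c : R) (f : R -> R) : 0 < c ->
  measurable_fun setT f -> (forall x, 0 <= f x) ->
  (\int[mu]_(x in `[(c * n.+1%:R^-1)%R, +oo[) (f x)%:E)%E @[n --> \oo] -->
  (\int[mu]_(x in `]0%R, +oo[) (f x)%:E)%E.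
Proof.
move=> c0 mf f0; rewrite (itv0y_bigcup c0).
apply: ge0_nondecreasing_set_cvg_integral => //=.
- move=> m n mn; apply/subsetPset => x /=; rewrite !in_itv/= !andbT.
  by apply: le_trans; rewrite ler_pM2l// lef_pV2 ?posrE// ler_nat.
- by move=> i; apply: measurable_funTS; exact/measurable_EFinP.
- by move=> i x _; rewrite lee_fin.
Qed.

Let powR1D_le (b x : R) : 0 < b -> 0 < x ->
  (1 + x) `^ b <= expR (1 - b + b * ln b) * expR x.
Proof.
move=> b0 x0; have x1 : 0 < 1 + x by rewrite addr_gt0.
rewrite -expRD /powR gt_eqF// ler_expR.
have /le_ln1Dx : -1 < (1 + x) / b - 1 by rewrite ltrBrDr addNr divr_gt0.
rewrite addrC subrK ln_div ?posrE// => h.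
have : b * (ln (1 + x) - ln b) <= b * ((1 + x) / b - 1) by rewrite ler_pM2l.
by rewrite [X in _ <= X -> _]mulrBr mulrCA divff ?gt_eqF//; lra.
Qed.

Let H (x : R) := x / (1 + x).

Let is_derive_H (x : R) : 0 < x -> is_derive x 1 H ((1 + x) ^- 2).
Proof.
move=> x0; have x1 : 1 + x != 0 by rewrite gt_eqF ?addr_gt0.
have dV := is_deriveV (f := fun x : R => 1 + x) x1.
apply: is_derive_eq.
by rewrite /GRing.scale/=; field.
Qed.

Let F a (x : R) := H x `^ a.

Let F' a (x : R) := a * x `^ (a - 1) / (1 + x) `^ (a + 1).

Let is_derive_F a (x : R) : 0 < x -> is_derive x 1 (F a) (F' a x).
Proof.
move=> x0; have x1 : 0 < 1 + x by rewrite addr_gt0.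
have Hx0 : 0 < H x by rewrite divr_gt0.
have := is_derive1_comp (is_derive1_powR a Hx0) (is_derive_H x0).
congr (is_derive _ _ _ _); rewrite /F' -!mulrA; congr (_ * _).
rewrite powRM ?invr_ge0 ?ltW// -!mulrA; congr (_ * _).
rewrite -powR_inv1 ?ltW// -powRrM mulN1r -(powR_mulrn _ (ltW x1)) -powRN -powRD.
  by rewrite -powRN; congr (_ `^ _); lra.
by rewrite (gt_eqF x1) implybT.
Qed.

Let F'_ge0 a x : 0 <= a -> 0 <= F' a x.
Proof. by move=> a0; rewrite !mulr_ge0 ?invr_ge0 ?powR_ge0. Qed.

Let continuous_powR b (x : R) : 0 < x -> {for x, continuous (fun x : R => x `^ b)}.
Proof.
move=> x0; have : derivable (fun x : R => x `^ b : R^o) x 1.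
  by apply: derivable_powR; rewrite in_itv/= x0.
by move/derivable1_diffP/differentiable_continuous.
Qed.

Let continuous_F' a (x : R) : 0 < x -> {for x, continuous (F' a)}.
Proof.
move=> x0; have x1 : 0 < 1 + x by rewrite addr_gt0.
apply: (@continuousM _ R^o (fun x => a * x `^ (a - 1))
    (fun x => ((1 + x) `^ (a + 1))^-1)).
  apply: (@continuousM _ R^o (cst a)); first exact: cst_continuous.
  exact: continuous_powR.
apply: (@continuousV _ R^o (fun x => (1 + x) `^ (a + 1))).
  by rewrite gt_eqF ?powR_gt0.
apply: (@continuous_comp _ _ _ (fun x => 1 + x) (fun x => x `^ (a + 1))).
  by apply: (@continuousD _ R^o R^o (cst 1) id) => //; exact: cst_continuous.
exact: continuous_powR.
Qed.

Let cvg_F a : F a x @[x --> +oo%R] --> (1 : R).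
Proof.
have -> : 1 = (1 - 0) `^ a :> R by rewrite subr0 powR1.
have h : (1 - (1 + x)^-1) @[x --> +oo%R] --> (1 - 0 : R).
  apply: (@cvgB _ R^o); first exact: cvg_cst.
  apply/gtr0_cvgV0.
    by near=> x; rewrite addr_gt0//; near: x; exact: nbhs_pinfty_gt.
  exact: cvg_addrl.
have : (1 - (1 + x)^-1) `^ a @[x --> +oo%R] --> ((1 - 0) `^ a : R).
  have cp : {for 1 - 0, continuous (fun x : R => x `^ a)}.
    by apply: continuous_powR; rewrite subr0.
  exact: (@continuous_cvg R R R (pinfty_nbhs R) _ (fun x => 1 - (1 + x)^-1)
    (fun x : R => x `^ a) (1 - 0) cp h).
apply: cvg_trans; apply: near_eq_cvg; near=> x.
have x0 : 0 < x by near: x; exact: nbhs_pinfty_gt.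
by rewrite /F /H; congr (_ `^ _); field; rewrite gt_eqF ?addr_gt0.
Unshelve. all: by end_near. Qed.

Let integral_F'_le1 a e : 0 <= a -> 0 < e ->
  (\int[mu]_(x in `[e, +oo[) (F' a x)%:E <= 1)%E.
Proof.
move=> a0 e0; rewrite (@ge0_continuous_FTC2y _ _ (F a) _ 1).
- by rewrite -EFinB lee_fin lerBlDr lerDl powR_ge0.
- by move=> x _; exact: F'_ge0.
- apply: continuous_in_subspaceT => x; rewrite inE/= in_itv/= andbT => ex.
  by apply: continuous_F'; exact: lt_le_trans ex.
- exact: cvg_F.
- move=> x ex; have x0 := lt_trans e0 ex.
  by have [] := is_derive_F a x0.
- apply: cvg_at_right_filter; have [+ _] := is_derive_F a e0.
  by move/derivable1_diffP/differentiable_continuous.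
- move=> x; rewrite in_itv/= andbT => ex; have x0 := lt_trans e0 ex.
  by rewrite derive1E; have [_] := is_derive_F a x0.
Qed.

Let gamma_fun_le a x : 0 < a -> 0 < x ->
  gamma_fun a x <= expR (1 - (a + 1) + (a + 1) * ln (a + 1)) / a * F' a x.
Proof.
move=> a0 x0; have x1 : 0 < 1 + x by rewrite addr_gt0.
have a1 : 0 < a + 1 by rewrite addr_gt0.
have := powR1D_le a1 x0; set K := expR _ => h.
rewrite /F' /gamma_fun mulrA [_ / a * _]mulrA divfK ?gt_eqF//.
rewrite mulrAC mulrC ler_wpM2r ?powR_ge0// expRN.
by rewrite ler_pdivlMr ?powR_gt0// mulrC ler_pdivrMr ?expR_gt0.
Qed.

Lemma integral_gamma_fun_lty a : 0 < a ->
  (\int[mu]_(x in `]0%R, +oo[) (gamma_fun a x)%:E < +oo)%E.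
Proof.
move=> a0; set K := expR (1 - (a + 1) + (a + 1) * ln (a + 1)) / a.
have K0 : 0 <= K by rewrite divr_ge0 ?expR_ge0 ?ltW.
apply: (@le_lt_trans _ _ K%:E); last by rewrite ltry.
have h := cvg_itv0y ltr01 (measurable_gamma_fun a) (gamma_fun_ge0 a).
rewrite -(cvg_lim _ h)//; apply: lime_le; first by apply/cvg_ex; eexists; exact: h.
apply: nearW => n.
have n0 : 0 < 1 * n.+1%:R^-1 :> R by rewrite mul1r invr_gt0.
have mF' : measurable_fun (`[1 * n.+1%:R^-1, +oo[%classic : set R) (F' a).
  apply: subspace_continuous_measurable_fun => //.
  apply: continuous_in_subspaceT => x; rewrite inE/= in_itv/= andbT => ex.
  by apply: continuous_F'; exact: lt_le_trans ex.
apply: (@le_trans _ _ (\int[mu]_(x in `[(1 * n.+1%:R^-1)%R, +oo[) (K%:E * (F' a x)%:E))%E).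
  apply: ge0_le_integral => //=.
  - by move=> x _; rewrite lee_fin gamma_fun_ge0.
  - by apply/measurable_EFinP; apply: measurable_funTS; exact: measurable_gamma_fun.
  - by apply/measurable_EFinP; apply: measurable_funM.
  - move=> x; rewrite in_itv/= andbT => nx.
    by rewrite -EFinM lee_fin gamma_fun_le//; exact: lt_le_trans nx.
rewrite ge0_integralZl//=; last 2 first.
- exact/measurable_EFinP.
- by move=> x _; rewrite lee_fin F'_ge0// ltW.
by rewrite -[leRHS]mule1 lee_pmul2l// ?integral_F'_le1 ?ltW// lte_fin divr_gt0 ?expR_gt0.
Qed.

Lemma integrable_gamma_fun a : 0 < a ->
  mu.-integrable `]0, +oo[ (EFin \o gamma_fun a).
Proof.
move=> a0; apply/integrableP; split.
  by apply/measurable_EFinP/measurable_funTS; exact: measurable_gamma_fun.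
under eq_integral do rewrite /= ger0_norm ?gamma_fun_ge0//.
exact: integral_gamma_fun_lty.
Qed.

Lemma EFin_Gamma a : 0 < a ->
  (Gamma a)%:E = (\int[mu]_(x in `]0%R, +oo[) (gamma_fun a x)%:E)%E.
Proof.
move=> a0; rewrite /Gamma /Rintegral fineK//.
by apply: integrable_fin_num => //; exact: integrable_gamma_fun.
Qed.

Lemma Gamma_gt0 a : 0 < a -> 0 < Gamma a.
Proof.
move=> a0; rewrite -lte_fin EFin_Gamma//.
pose c := 2^-1 * expR (- 2) : R.
have c0 : 0 < c by rewrite mulr_gt0 ?expR_gt0.
apply: (@lt_le_trans _ _ (\int[mu]_(x in `[1%R, 2%R]) c%:E)%E).
  rewrite integral_cst//= lebesgue_measure_itv/= lte_fin.
  by rewrite ltr1n -EFinB -EFinM lte_fin mulr_gt0// subr_gt0 ltr1n.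
apply: (@le_trans _ _ (\int[mu]_(x in `[1%R, 2%R]) (gamma_fun a x)%:E)%E).
  apply: ge0_le_integral => //=.
  - by move=> x _; rewrite lee_fin ltW.
  - by apply/measurable_EFinP/measurable_funTS; exact: measurable_gamma_fun.
  - move=> x; rewrite in_itv/= => /andP[x1 x2]; rewrite lee_fin.
    apply: ler_pM => //.
    + apply: (@le_trans _ _ (x `^ (-1))); last by apply: ler_powR => //; lra.
      by rewrite powR_inv1 ?lef_pV2 ?posrE//; lra.
    + by rewrite ler_expR lerN2.
apply: ge0_subset_integral => //=.
- by apply/measurable_EFinP/measurable_funTS; exact: measurable_gamma_fun.
- by move=> x _; rewrite lee_fin gamma_fun_ge0.
- by move=> x /=; rewrite !in_itv/= andbT => /andP[x1 _]; exact: lt_le_trans x1.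
Qed.

Definition chi2_fun (nu x : R) : R := x `^ (nu / 2 - 1) * expR (- (x / 2)).

Let chi2_funE nu x : 0 < x ->
  chi2_fun nu x = (2 : R) `^ (nu / 2) * (gamma_fun (nu / 2) (x / 2) * 2^-1).
Proof.
move=> x0; rewrite /chi2_fun /gamma_fun.
have -> : (2 : R) `^ (nu / 2) = (2 : R) `^ (nu / 2 - 1) * (2 : R) `^ 1.
  by rewrite -powRD ?subrK// pnatr_eq0 implybT.
rewrite powRr1//.
rewrite [RHS](_ : _ = ((2 : R) `^ (nu / 2 - 1) * (x / 2) `^ (nu / 2 - 1)) *
  expR (- (x / 2))); last by field.
by rewrite -powRM ?divr_ge0 ?ltW// mulrCA divff// mulr1.
Qed.

Let integral_half_itv a e : 0 < e ->
  (\int[mu]_(x in `[(2^-1 * e)%R, +oo[) (gamma_fun a x)%:E =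
   \int[mu]_(x in `[e, +oo[) (gamma_fun a (x / 2) * 2^-1)%:E)%E.
Proof.
move=> e0; pose G (x : R) := 2^-1 * x.
have dG x : is_derive x 1 G 2^-1.
  by apply: is_derive_eq; rewrite /GRing.scale/= mulr1.
have G'E : G^`()%classic = cst 2^-1.
  by apply/funext => x; rewrite derive1E; have [_] := dG x.
rewrite (_ : (2^-1 * e)%R = G e)// increasing_ge0_integration_by_substitutiony.
- by apply: eq_integral => x _; rewrite G'E /=; congr (gamma_fun _ _ * _)%:E; exact: mulrC.
- by move=> x y _ _ xy; rewrite /G ltr_pM2l.
- by rewrite G'E => x _; exact: cst_continuous.
- by rewrite G'E; exact: is_cvg_cst.
- by rewrite G'E; exact: is_cvg_cst.
- split=> [x _|]; first by have [] := dG x.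
  apply: cvg_at_right_filter; have [+ _] := dG e.
  by move/derivable1_diffP/differentiable_continuous.
- by apply: gt0_cvgMry => //; exact: cvg_id.
- apply: continuous_in_subspaceT => x; rewrite inE/= in_itv/= andbT => ex.
  by apply: continuous_gamma_fun; apply: lt_le_trans ex; rewrite mulr_gt0.
- by move=> x _; exact: gamma_fun_ge0.
Qed.

Lemma measurable_chi2_fun nu : measurable_fun setT (chi2_fun nu).
Proof.
apply: measurable_funM; first exact: measurable_powR.
apply: measurableT_comp => //; apply: measurableT_comp => //.
exact: measurable_funM.
Qed.

Lemma integral_chi2_fun nu : 0 < nu ->
  (\int[mu]_(x in `]0%R, +oo[) (chi2_fun nu x)%:E =
   (2 `^ (nu / 2) * Gamma (nu / 2))%:E)%E.
Proof.
move=> nu0; have nu20 : 0 < nu / 2 by rewrite divr_gt0.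
pose g x := gamma_fun (nu / 2) (x / 2) * 2^-1.
have mg : measurable_fun setT g.
  apply: measurable_funM => //; apply: measurableT_comp.
    exact: measurable_gamma_fun.
  exact: measurable_funM.
have g0 x : 0 <= g x by rewrite mulr_ge0 ?gamma_fun_ge0.
have h2 : 0 < 2^-1 :> R by [].
have h := cvg_itv0y h2 (measurable_gamma_fun (nu / 2)) (gamma_fun_ge0 (nu / 2)).
have h' := cvg_itv0y ltr01 mg g0.
rewrite EFinM EFin_Gamma// (_ : (\int[mu]_(x in _) (gamma_fun _ x)%:E =
    \int[mu]_(x in `]0%R, +oo[) (g x)%:E)%E); last first.
  apply: (cvg_unique (@ereal_hausdorff R) h).
  apply: cvg_trans h'; apply: near_eq_cvg; apply: nearW => n.
  by rewrite mul1r integral_half_itv.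
rewrite -ge0_integralZl//=; last 2 first.
- by apply/measurable_EFinP/measurable_funTS.
- by move=> x _; rewrite lee_fin.
apply: eq_integral => x; rewrite inE/= in_itv/= andbT => x0.
by rewrite chi2_funE// EFinM.
Qed.

End gamma.

Section chi2.
Context {R : realType}.
Implicit Types nu x : R.
Notation mu := (@lebesgue_measure R).

(* The value for nu <= 0 is arbitrary: it makes chi2_prob nu a probability
   measure for all nu, as the library does for normal_pdf with null deviation. *)
Definition chi2_pdf nu x : R :=
  if nu <= 0 then \1_`[0, 1] x
  else (chi2_fun nu \_ `]0, +oo[) x / (2 `^ (nu / 2) * Gamma (nu / 2)).

Lemma chi2_pdf_ge0 nu x : 0 <= chi2_pdf nu x.
Proof.
rewrite /chi2_pdf; case: ifPn => // nu0; apply: mulr_ge0.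
  by apply: restrict_ge0 => y _; rewrite mulr_ge0 ?powR_ge0 ?expR_ge0.
by rewrite invr_ge0 mulr_ge0 ?powR_ge0// ltW// Gamma_gt0// divr_gt0// ltNge.
Qed.

Lemma measurable_chi2_pdf nu : measurable_fun setT (chi2_pdf nu).
Proof.
have mr : measurable_fun setT (chi2_fun nu \_ `]0, +oo[).
  apply/measurable_restrict => //; apply: measurable_funTS.
  exact: measurable_chi2_fun.
rewrite /chi2_pdf; case: (nu <= 0) => /=; first exact: measurable_indic.
exact: measurable_funM.
Qed.

Lemma integral_chi2_pdf nu : (\int[mu]_x (chi2_pdf nu x)%:E = 1)%E.
Proof.
rewrite /chi2_pdf; have [nu0|nu0] := leP nu 0.
  by rewrite integral_indic//= setIT lebesgue_measure_itv/= lte01 oppr0 adde0.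
set C := 2 `^ _ * _; have C0 : 0 < C.
  by rewrite mulr_gt0 ?powR_gt0// Gamma_gt0// divr_gt0.
under eq_integral do rewrite mulrC EFinM.
have mr : measurable_fun setT (chi2_fun nu \_ `]0, +oo[).
  apply/measurable_restrict => //; apply: measurable_funTS.
  exact: measurable_chi2_fun.
rewrite ge0_integralZl//=; last 3 first.
- exact/measurable_EFinP.
- move=> x _; rewrite lee_fin; apply: restrict_ge0 => y _.
  by rewrite mulr_ge0 ?powR_ge0 ?expR_ge0.
- by rewrite lee_fin invr_ge0 ltW.
have -> : (\int[mu]_x ((chi2_fun nu \_ `]0, +oo[) x)%:E =
    \int[mu]_(x in `]0%R, +oo[) (chi2_fun nu x)%:E)%E.
  by rewrite [RHS]integral_mkcond restrict_EFin.
by rewrite integral_chi2_fun// -EFinM mulVf// gt_eqF.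
Qed.

End chi2.

Definition chi2_prob {R : realType} (nu : R) : set R -> \bar R :=
  fun V => (\int[lebesgue_measure]_(x in V) (chi2_pdf nu x)%:E)%E.

Section chi2_probability.
Context {R : realType}.
Variable nu : R.

Let chi20 : chi2_prob nu set0 = 0%E.
Proof. by rewrite /chi2_prob integral_set0. Qed.

Let chi2_ge0 A : (0 <= chi2_prob nu A)%E.
Proof. by apply: integral_ge0 => x _; rewrite lee_fin chi2_pdf_ge0. Qed.

Let chi2_sigma_additive : semi_sigma_additive (chi2_prob nu).
Proof.
move=> F mF tF mUF; rewrite /chi2_prob ge0_integral_bigcup//=; last 2 first.
- by apply/measurable_EFinP/measurable_funTS; exact: measurable_chi2_pdf.
- by move=> x _; rewrite lee_fin chi2_pdf_ge0.
apply: is_cvg_ereal_nneg_natsum_cond => n _ _.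
by apply: integral_ge0 => x _; rewrite lee_fin chi2_pdf_ge0.
Qed.

HB.instance Definition _ := isMeasure.Build _ _ _
  (chi2_prob nu) chi20 chi2_ge0 chi2_sigma_additive.

Let chi2_setT : chi2_prob nu setT = 1%E.
Proof. exact: integral_chi2_pdf. Qed.

HB.instance Definition _ :=
  @Measure_isProbability.Build _ _ R (chi2_prob nu) chi2_setT.

End chi2_probability.

Section noncentral_t.
Context {R : realType}.
Implicit Types nu lambda : R.

Definition t_stat nu lambda (zw : R * R) : R :=
  (zw.1 + lambda) / Num.sqrt (zw.2 / nu).

Definition t_dist nu lambda : set R -> \bar R :=
  pushforward (normal_prob 0 1 \x chi2_prob nu)%E (t_stat nu lambda).

Let measurable_inv : measurable_fun setT (@GRing.inv R).
Proof.
rewrite -(setUv [set 0]); apply/measurable_funU => //.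
  exact: measurableC.
split; first exact: measurable_fun_set1.
apply: open_continuous_measurable_fun; first exact: closed_openC.
by move=> x; rewrite inE/= => /eqP x0; exact: inv_continuous.
Qed.

Lemma measurable_t_stat nu lambda : measurable_fun setT (t_stat nu lambda).
Proof.
apply: measurable_funM; first exact: measurable_funD.
apply: measurableT_comp => //; apply: measurableT_comp; last first.
  exact: measurable_funM.
by apply: continuous_measurable_fun; exact: sqrt_continuous.
Qed.

End noncentral_t.

Section noncentral_t_probability.
Context {R : realType}.
Variables nu lambda : R.

Let mpre A : measurable A -> measurable (t_stat nu lambda @^-1` A).
Proof.
by move=> mA; rewrite -[X in measurable X]setTI; exact: measurable_t_stat.
Qed.

Let t_dist0 : t_dist nu lambda set0 = 0%E.
Proof. by rewrite /t_dist /pushforward preimage_set0 measure0. Qed.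

Let t_dist_ge0 A : (0 <= t_dist nu lambda A)%E.
Proof. by rewrite /t_dist /pushforward; apply: measure_ge0. Qed.

Let t_dist_sigma_additive : semi_sigma_additive (t_dist nu lambda).
Proof.
move=> F mF tF mUF; rewrite /t_dist /pushforward preimage_bigcup.
apply: measure_semi_sigma_additive.
- by move=> n; exact: mpre.
- apply/trivIsetP => /= i j _ _ ij; rewrite -preimage_setI.
  by move/trivIsetP : tF => /(_ _ _ _ _ ij) ->//; rewrite preimage_set0.
- by rewrite -preimage_bigcup; exact: mpre.
Qed.

HB.instance Definition _ := isMeasure.Build _ _ _
  (t_dist nu lambda) t_dist0 t_dist_ge0 t_dist_sigma_additive.

Let t_dist_setT : t_dist nu lambda setT = 1%E.
Proof.
rewrite /t_dist /pushforward preimage_setT -setXTT product_measure1E//.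
by rewrite [X in (X * _)%E]probability_setT [X in (_ * X)%E]probability_setT mul1e.
Qed.

HB.instance Definition _ :=
  @Measure_isProbability.Build _ _ R (t_dist nu lambda) t_dist_setT.

End noncentral_t_probability.

Section densities.
Context {R : realType}.
Notation mu := (@lebesgue_measure R).

Definition is_pdf (P : probability R R) (f : R -> R) :=
  [/\ measurable_fun setT f, forall x, 0 <= f x &
      forall A, measurable A -> P A = (\int[mu]_(x in A) (f x)%:E)%E].

(* A density is determined only almost everywhere; pointwise values of the
   Bayes factor refer to the continuous version, which is unique. *)
Definition t_pdf (nu lambda : R) : R -> R :=
  xget (fun=> 0) [set f | is_pdf (t_dist nu lambda) f /\ continuous f].

Definition normal_moment_pdf (mu0 tau x : R) : R :=
  (x - mu0) ^+ 2 / (Num.sqrt (2 * pi) * tau ^+ 3) *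
  expR (- ((x - mu0) ^+ 2 / (2 * tau ^+ 2))).

Definition marginal_pdf (f : R -> R -> R) (prior : R -> R) (x : R) : R :=
  \int[mu]_lambda (f lambda x * prior lambda).

Definition bayes_factor (m1 m0 : R -> R) (x : R) : R := m1 x / m0 x.

End densities.

(* Main.v *)
(* Given W = w the statistic is Gaussian, so T(nu, lambda) has density
   t |-> E[sqrt(W / nu) phi(t sqrt(W / nu) - lambda)], which is continuous by
   domination. Averaging over lambda under the integral in w leaves
   phi * (x^2 phi_tau), evaluated at u = t sqrt(w / nu); completing the square
   reduces it to a second moment of a normal law and gives
   (1 + tau^2)^(-3/2) e^(-u^2 / (2 (1 + tau^2))) (1 + u^2 tau^2 / (1 + tau^2))
   up to the factor 1 / sqrt(2 pi). What remains in w is a sum of two gamma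
   integrals, related by Gamma(a + 1) = a Gamma(a). *)
From HB Require Import structures.
Require Import Defs.
From mathcomp Require Import all_boot all_order all_algebra.
From mathcomp Require Import all_classical all_reals all_analysis.
From mathcomp Require Import measurable_realfun ring lra.

Import Order.TTheory GRing.Theory Num.Theory.
Import numFieldNormedType.Exports.
Local Open Scope ring_scope.
Local Open Scope classical_set_scope.

Set Implicit Arguments.
Unset Strict Implicit.
Unset Printing Implicit Defensive.

(** * Change of variables and densities *)

(** Since [t_pdf] is a choice among continuous densities, nothing can be computed before a concrete
    continuous density is produced and shown to be the only one. The recursion of Gamma and the
    second moment of the normal law are classically obtained by integration by parts on an unbounded
    domain. Here both come from homogeneity: if the integral of g h e^(-c h) equals B c^(-(b + 1))
    for all c >= 1, integrating over c gives B / b for the integral of g e^(-h). All integrands stay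
    nonnegative, so the exchanges of integrals take place in the extended reals and carry no
    integrability condition. The peak of the normal density, [t_cst nu] and Gamma((nu + 1) / 2)
    occur in both marginal densities and cancel in the quotient, so none of them has to be
    evaluated. *)

(** [f] and the Radon-Nikodym derivative of [P] have the same integral over every measurable set,
    hence agree almost everywhere, and the change of variables known for the derivative carries over
    to [f]. *)
Lemma ge0_integral_is_pdf (R : realType) (P : probability R R) (f : R -> R)
    (g : R -> \bar R) : is_pdf P f -> measurable_fun setT g ->
  (forall x, (0 <= g x)%E) ->
  (\int[P]_x g x = \int[lebesgue_measure]_x (g x * (f x)%:E))%E.
Proof.
move=> [mf f0 Pf] mg g0; set mu := @lebesgue_measure R.
(* Q is P carried to the measurable structure of lebesgue_measure, whose display
   differs from the default one of R. *)
have mX : measurable_fun [set: R] (idfun : R -> measurableTypeR R).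
  exact: (@measurable_id _ R setT).
pose X : {RV P >-> measurableTypeR R} :=
  HB.pack (idfun : R -> measurableTypeR R) (isMeasurableFun.Build _ _ _ _ _ mX).
pose Q : probability (measurableTypeR R) R := distribution P X.
have Qmu : Q `<< mu.
  apply/null_content_dominatesP => A mA A0.
  rewrite [LHS]Pf//; apply: null_set_integral => //.
  exact/measurable_EFinP/measurable_funTS.
transitivity (\int[Q]_x g x)%E.
  by rewrite /Q /distribution ge0_integral_pushforward//.
rewrite -(Radon_Nikodym_SigmaFinite.change_of_variables Qmu)//.
apply: ae_eq_integral => //.
- apply: emeasurable_funM => //.
  exact: measurable_int (Radon_Nikodym_SigmaFinite.f_integrable Qmu).
- by apply: emeasurable_funM => //; exact/measurable_EFinP.
apply: ae_eqe_mul2l; apply: integral_ae_eq => //.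
- exact: Radon_Nikodym_SigmaFinite.f_integrable.
- exact/measurable_EFinP.
- move=> E _ mE; rewrite -Pf//.
  by rewrite -(Radon_Nikodym_SigmaFinite.f_integral Qmu).
Qed.

(** Lebesgue measure is [c] times its own image under x |-> c x + d: the two measures agree on
    half-open intervals, and uniqueness does the rest. *)
Lemma ge0_integral_affine (R : realType) (c d : R) (f : R -> \bar R) :
  0 < c -> measurable_fun setT f -> (forall x, (0 <= f x)%E) ->
  (\int[lebesgue_measure]_x f x =
   c%:E * \int[lebesgue_measure]_x f (c * x + d)%R)%E.
Proof.
move=> c0 mf f0; pose phi (x : R) := c * x + d.
have mphi :
    measurable_fun [set: measurableTypeR R] (phi : _ -> measurableTypeR R).
  by apply: measurable_funD => //; exact: measurable_funM.
pose m := mscale (NngNum (ltW c0))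
  (measure_function_pushforward__canonical__measure_function_Measure
    (@lebesgue_measure R) mphi).
have muE A : measurable A -> lebesgue_measure A = m A.
  apply: lebesgue_measure_unique => _ [[a b] _ <-] /=.
  rewrite /m /mscale/= /pushforward.
  have -> : phi @^-1` `]a, b] = `](a - d) / c, (b - d) / c]%classic.
    apply/seteqP; split => x /=;
      rewrite !in_itv/= /phi ltr_pdivrMr// ler_pdivlMr//.
      by rewrite ltrBlDr lerBrDr mulrC.
    by rewrite ltrBlDr lerBrDr mulrC.
  rewrite !lebesgue_measure_itv/= !lte_fin ltr_pM2r ?invr_gt0// ltrD2r.
  case: ifPn => _; last by rewrite mule0.
  by rewrite -!EFinD -EFinM; congr _%:E; field; rewrite gt_eqF.
rewrite (eq_measure_integral m); last by move=> A mA _; exact: muE.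
rewrite ge0_integral_mscale//; congr (_ * _)%E.
by rewrite ge0_integral_pushforward//.
Qed.

(** If f exceeded g at a point, continuity would give f >= g + e on a whole interval around it, and
    the finite probability of that interval would exceed itself by e times the length. *)
Lemma is_pdf_continuous_unique (R : realType) (P : probability R R)
    (f g : R -> R) :
  is_pdf P f -> continuous f -> is_pdf P g -> continuous g -> f = g.
Proof.
wlog suff : f g / is_pdf P f -> continuous f -> is_pdf P g -> continuous g ->
    forall x, f x <= g x.
  move=> H Pf cf Pg cg; apply/funext => x; apply/eqP.
  by rewrite eq_le !H.
move=> [mf f0 Pf] cf [mg g0 Pg] cg x; rewrite leNgt; apply/negP => gf.
pose e := (f x - g x) / 2.
have e0 : 0 < e by rewrite divr_gt0// subr_gt0.
have : \forall y \near x, g y + e <= f y.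
  have : (f y - g y) @[y --> x] --> f x - g x.
    by apply: cvgB; [exact: cf|exact: cg].
  move=> /cvgr_ge /(_ e); rewrite /e => h.
  have : (f x - g x) / 2 < f x - g x.
    by rewrite ltr_pdivrMr// ltr_pMr ?subr_gt0// ltr1n.
  by move/h; apply: filterS => y; lra.
move=> /nbhs_ballP[d /= d0 dP].
pose A := `[x - d / 2, x + d / 2]%classic.
have mA : measurable A by exact: measurable_itv.
have : (\int[lebesgue_measure]_(y in A) (g y + e)%:E <=
    \int[lebesgue_measure]_(y in A) (f y)%:E)%E.
  apply: ge0_le_integral => //.
  - by move=> y _; rewrite lee_fin addr_ge0// ltW.
  - by apply/measurable_EFinP/measurable_funTS/measurable_funD.
  - by apply/measurable_EFinP/measurable_funTS.
  - move=> y; rewrite /A/= in_itv/= => /andP[y1 y2]; rewrite lee_fin; apply: dP.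
    by rewrite /ball/= ltr_distlC; apply/andP; split; lra.
under eq_integral do rewrite EFinD.
rewrite ge0_integralD//; [|by move=> y _; rewrite lee_fin|
  exact/measurable_EFinP/measurable_funTS|by move=> y _; rewrite lee_fin ltW].
rewrite -Pf// -Pg// integral_cst//= lebesgue_measure_itv/= lte_fin.
have -> : x - d / 2 < x + d / 2 by lra.
have : P A \is a fin_num by exact: fin_num_measure.
case: (P A) => // p _; rewrite -EFinB -EFinM -EFinD lee_fin leNgt => /negP; apply.
by rewrite ltrDl mulr_gt0//; lra.
Qed.

(** By uniqueness the set from which [t_pdf] chooses has at most one element, so any exhibited
    element is the chosen one. *)
Lemma t_pdf_eq (R : realType) (nu lambda : R) (f : R -> R) :
  is_pdf (t_dist nu lambda) f -> continuous f -> t_pdf nu lambda = f.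
Proof.
move=> Pf cf; rewrite /t_pdf; apply: xget_subset1 => // g h [Pg cg] [Ph ch].
exact: is_pdf_continuous_unique Pg cg Ph ch.
Qed.

(** * Integrals of exponentials *)

(** Tonelli on the full product, applied to [f] extended by 0 outside the rectangle. *)
Lemma ge0_fubini_tonelli_in d1 d2 (T1 : measurableType d1)
    (T2 : measurableType d2) (R : realType)
    (m1 : {sigma_finite_measure set T1 -> \bar R})
    (m2 : {sigma_finite_measure set T2 -> \bar R}) (D : set T1) (E : set T2)
    (f : T1 * T2 -> \bar R) :
  measurable D -> measurable E -> measurable_fun setT f ->
  (forall z, (0 <= f z)%E) ->
  (\int[m1]_(x in D) \int[m2]_(y in E) f (x, y) =
   \int[m2]_(y in E) \int[m1]_(x in D) f (x, y))%E.
Proof.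
move=> mD mE mf f0; pose g := (f \_ (D `*` E)).
have mg : measurable_fun setT g.
  apply/(measurable_restrictT _ (measurableX mD mE)).
  exact: measurable_funTS.
have g0 z : (0 <= g z)%E by rewrite /g patchE; case: ifPn.
have := @fubini_tonelli _ _ _ _ _ m1 m2 g mg g0.
congr (_ = _).
- rewrite [RHS]integral_mkcond; apply: eq_integral => x _.
  rewrite patchE; case: ifPn => xD.
    rewrite [RHS]integral_mkcond; apply: eq_integral => y _.
    by rewrite /g !patchE in_setX/= xD.
  by rewrite integral0_eq// => y _; rewrite /g patchE in_setX/= (negbTE xD).
- rewrite [RHS]integral_mkcond; apply: eq_integral => y _.
  rewrite patchE; case: ifPn => yE.
    rewrite [RHS]integral_mkcond; apply: eq_integral => x _.
    by rewrite /g !patchE in_setX/= yE andbT.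
  rewrite integral0_eq// => x _.
  by rewrite /g patchE in_setX/= (negbTE yE) andbF.
Qed.

Lemma integral_expRN (R : realType) (k : R) : 0 < k ->
  (\int[lebesgue_measure]_(c in `[1%R, +oo[) (k * expR (- (k * c)))%:E =
   (expR (- k))%:E)%E.
Proof.
move=> k0; pose F (c : R) := - expR (- (k * c)).
have dF (c : R) : is_derive c 1 F (k * expR (- (k * c))).
  by apply: is_derive_eq; rewrite /GRing.scale/=; ring.
rewrite (@ge0_continuous_FTC2y _ _ F _ 0).
- by rewrite /F mulr1 -EFinB sub0r opprK.
- by move=> x _; rewrite mulr_ge0 ?expR_ge0// ltW.
- apply: continuous_subspaceT => x.
  apply: (@continuousM _ R^o (cst k) (fun c => expR (- (k * c)))).
    exact: cst_continuous.
  apply: continuous_comp; last exact: continuous_expR.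
  apply: (@continuousN _ R^o R^o (fun c => k * c)).
  by apply: (@continuousM _ R^o (cst k) id) => //; exact: cst_continuous.
- rewrite -[X in _ --> X]oppr0; apply: (@cvgN _ R^o).
  apply: (@cvg_comp _ _ _ (fun c => k * c) (fun c => expR (- c)) _ +oo%R).
    by apply: gt0_cvgMry => //; exact: cvg_id.
  exact: cvgr_expR.
- by move=> x _; have [] := dF x.
- apply: cvg_at_right_filter; have [+ _] := dF 1.
  by move/derivable1_diffP/differentiable_continuous.
- by move=> x _; rewrite derive1E; have [_] := dF x.
Qed.

Lemma integral_powRN (R : realType) (b : R) : 0 < b ->
  (\int[lebesgue_measure]_(c in `[1%R, +oo[) (c `^ (- (b + 1)))%:E =
   (b^-1)%:E)%E.
Proof.
move=> b0; pose F (c : R) := - b^-1 * c `^ (- b).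
have dF (c : R) : 0 < c -> is_derive c 1 F (c `^ (- (b + 1))).
  move=> c0; have dp := is_derive1_powR (- b) c0.
  apply: is_derive_eq; rewrite /GRing.scale/= !mulrA mulrNN mulVf ?gt_eqF// mul1r.
  by congr (_ `^ _); ring.
rewrite (@ge0_continuous_FTC2y _ _ F _ 0).
- by rewrite /F powR1 mulr1 -EFinB sub0r opprK.
- by move=> x _; exact: powR_ge0.
- apply: continuous_in_subspaceT => x; rewrite inE/= in_itv/= andbT => x1.
  have : derivable (fun x : R => x `^ (- (b + 1)) : R^o) x 1.
    by apply: derivable_powR; rewrite in_itv/= (lt_le_trans ltr01 x1).
  by move/derivable1_diffP/differentiable_continuous.
- rewrite -[X in _ --> X](mulr0 (- b^-1)).
  apply: (@cvgM _ R^o); first exact: cvg_cst.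
  (* The decay of c^(-b) at infinity is read off from its form e^(-b ln c). *)
  have lny : (@ln R) x @[x --> +oo%R] --> +oo%R.
    apply/(@cvgryPge R R (pinfty_nbhs R) _ (@ln R)) => A; near=> x.
    have x0 : 0 < x by near: x; exact: nbhs_pinfty_gt.
    have : expR A <= x by near: x; apply: nbhs_pinfty_ge; rewrite num_real.
    by rewrite -{1}(lnK x0) ler_expR.
  have : expR (- (b * ln x)) @[x --> +oo%R] --> (0 : R).
    apply: (@cvg_comp _ _ _ (fun x : R => b * ln x) (fun x => expR (- x)) _ +oo%R).
      exact: gt0_cvgMry.
    exact: cvgr_expR.
  apply: cvg_trans; apply: near_eq_cvg; near=> x.
  have x0 : 0 < x by near: x; exact: nbhs_pinfty_gt.
  by rewrite /powR gt_eqF// mulNr.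
- by move=> x x1; have [] := dF x (lt_trans ltr01 x1).
- apply: cvg_at_right_filter; have [+ _] := dF 1 ltr01.
  by move/derivable1_diffP/differentiable_continuous.
- move=> x; rewrite in_itv/= andbT => x1.
  by rewrite derive1E; have [_] := dF x (lt_trans ltr01 x1).
Unshelve. all: by end_near. Qed.

(* Integrate the hypothesis over c in [1, +oo[ and exchange the integrals, using
   that h e^(-c h) integrates to e^(-h). *)
Lemma integral_expRN_of_scaling d (T : measurableType d) (R : realType)
    (m : {sigma_finite_measure set T -> \bar R}) (D : set T) (g h : T -> R)
    (b : R) (B : \bar R) :
  measurable D -> measurable_fun setT g -> measurable_fun setT h ->
  (forall x, 0 <= g x) -> (forall x, 0 <= h x) -> (forall x, D x -> 0 < h x) ->
  0 < b -> (0 <= B)%E ->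
  (forall c : R, 1 <= c -> (
    \int[m]_(x in D) (g x * h x * expR (- (h x * c)))%:E =
    B * (c `^ (- (b + 1)))%:E)%E) ->
  (\int[m]_(x in D) (g x * expR (- h x))%:E = B * (b^-1)%:E)%E.
Proof.
move=> mD mg mh g0 h0 hD b0 B0 H.
rewrite -(integral_powRN b0) -ge0_integralZl//=; last 2 first.
- by apply/measurable_EFinP/measurable_funTS; exact: measurable_powR.
- by move=> x _; rewrite lee_fin powR_ge0.
under [RHS]eq_integral => c.
  rewrite inE/= in_itv/= andbT => c1; rewrite -(H c c1); over.
pose f (z : T * R) : \bar R := (g z.1 * h z.1 * expR (- (h z.1 * z.2)))%:E.
rewrite -(@ge0_fubini_tonelli_in _ _ _ _ _ m (@lebesgue_measure R)
  D `[1, +oo[%classic f)//.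
- apply: eq_integral => x /[!inE] Dx.
  rewrite EFinM -(integral_expRN (hD _ Dx)) -ge0_integralZl//=.
  + by apply: eq_integral => c _; rewrite /f/= -EFinM mulrA.
  + apply/measurable_EFinP/measurable_funTS/measurable_funM => //.
    by apply: measurableT_comp => //; apply: measurableT_comp => //.
  + by move=> c _; rewrite lee_fin mulr_ge0 ?expR_ge0.
  + by rewrite lee_fin.
- apply/measurable_EFinP; apply: measurable_funM.
    by apply: measurable_funM; exact: measurableT_comp.
  apply: measurableT_comp => //; apply: measurableT_comp => //.
  by apply: measurable_funM => //; exact: measurableT_comp.
- by move=> z; rewrite lee_fin !mulr_ge0 ?expR_ge0.
Qed.

(** * Gamma integrals *)

Lemma measurable_powR_expRN (R : realType) (a c : R) :
  measurable_fun setT (fun x => x `^ a * expR (- (x * c))).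
Proof.
apply: measurable_funM; first exact: measurable_powR.
by do 2 apply: measurableT_comp => //; exact: measurable_funM.
Qed.

(** Substitution of c x for x. The affine rule is stated on the whole line, so the integrands are
    first restricted to the open half-line, which is invariant under multiplication by [c]. *)
Lemma integral_gamma_scaled (R : realType) (a c : R) : 0 < a -> 0 < c ->
  (\int[lebesgue_measure]_(x in `]0%R, +oo[)
    (x `^ (a - 1) * expR (- (x * c)))%:E = (Gamma a * c `^ (- a))%:E)%E.
Proof.
move=> a0 c0; set D : set R := `]0, +oo[%classic.
have mD : measurable D by exact: measurable_itv.
pose f x := ((gamma_fun a \_ D) x)%:E.
pose k x : R := x `^ (a - 1) * expR (- (x * c)).
have mk : measurable_fun setT k by exact: measurable_powR_expRN.
have k0 x : 0 <= k x by rewrite mulr_ge0 ?powR_ge0 ?expR_ge0.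
have mf : measurable_fun setT f.
  apply/measurable_EFinP/(measurable_restrictT _ mD).
  apply: measurable_funTS; exact: measurable_gamma_fun.
have f0 x : (0 <= f x)%E.
  by rewrite lee_fin; apply: restrict_ge0 => y _; exact: gamma_fun_ge0.
have fE x : f (c * x + 0) = ((c `^ (a - 1))%:E * ((k \_ D) x)%:E)%E.
  rewrite addr0 /f !patchE.
  have -> : (c * x \in D) = (x \in D).
    by apply/idP/idP; rewrite !inE /D/= !in_itv/= !andbT pmulr_rgt0.
  case: ifPn => [/[!inE]|_]; last by rewrite -EFinM mulr0.
  rewrite /D/= in_itv/= andbT => x0.
  by rewrite /gamma_fun powRM ?ltW// -EFinM /k !mulrA [x * c]mulrC.
have kE : (\int[lebesgue_measure]_(x in D) (k x)%:E =
    \int[lebesgue_measure]_x ((k \_ D) x)%:E)%E.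
  by rewrite integral_mkcond restrict_EFin.
have : ((Gamma a)%:E = c%:E * ((c `^ (a - 1))%:E *
    \int[lebesgue_measure]_(x in D) (k x)%:E))%E.
  rewrite EFin_Gamma// integral_mkcond restrict_EFin.
  rewrite (ge0_integral_affine 0 c0 mf f0) kE; congr (_ * _)%E.
  under eq_integral do rewrite fE.
  rewrite ge0_integralZl//.
  - apply/measurable_EFinP/(measurable_restrictT _ mD).
    exact: measurable_funTS.
  - by move=> x _; rewrite lee_fin; apply: restrict_ge0 => y _; exact: k0.
  - by rewrite lee_fin powR_ge0.
rewrite muleA -EFinM mulrC -{2}(powRr1 (ltW c0)) -powRD; last first.
  by rewrite (gt_eqF c0) implybT.
rewrite subrK EFinM => ->; rewrite muleAC -EFinM -powRD; last first.
  by rewrite (gt_eqF c0) implybT.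
by rewrite subrr powRr0 mul1e.
Qed.

(** The scaling principle with g = x^(a - 1), h = x and b = a: the integral of x^a e^(-c x) is
    Gamma(a + 1) c^(-(a + 1)). The absolute value stands for h because that principle asks for h >=
    0 on the whole line. *)
Lemma GammaD1 (R : realType) (a : R) : 0 < a -> Gamma (a + 1) = a * Gamma a.
Proof.
move=> a0; have a10 : 0 < a + 1 by rewrite addr_gt0.
suff -> : Gamma a = Gamma (a + 1) * a^-1.
  by rewrite mulrCA divff ?mulr1// gt_eqF.
apply: EFin_inj; rewrite EFin_Gamma// EFinM.
rewrite -(@integral_expRN_of_scaling _ _ _ (@lebesgue_measure R) `]0, +oo[%classic
  (fun x => x `^ (a - 1)) Num.norm a (Gamma (a + 1))%:E)//.
- apply: eq_integral => x; rewrite inE/= in_itv/= andbT => x0.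
  by rewrite gtr0_norm.
- by move=> x; exact: powR_ge0.
- by move=> x; rewrite /= in_itv/= andbT => x0; rewrite normr_gt0 gt_eqF.
- by rewrite lee_fin ltW// Gamma_gt0.
move=> c c1; have c0 := lt_le_trans ltr01 c1.
rewrite -EFinM -integral_gamma_scaled//.
apply: eq_integral => x; rewrite inE/= in_itv/= andbT => x0.
rewrite gtr0_norm// -{2}(powRr1 (ltW x0)) -powRD; last first.
  by rewrite (gt_eqF x0) implybT.
by congr (_ `^ _ * _)%:E; ring.
Qed.

(** * Second moment of the normal law *)

Lemma normal_pdf01E (R : realType) (x : R) :
  normal_pdf 0 1 x = normal_peak 1 * expR (- (x ^+ 2 / 2)).
Proof. by rewrite normal_pdfE ?oner_eq0// /normal_fun subr0 expr1n mulNr. Qed.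

(** The scaling principle with g = 1, h = x^2 / 2 and b = 1/2: it turns the integral [B] of h e^(-h)
    into half the integral of e^(-h). [B] lives in the extended reals, so its finiteness need not be
    known beforehand. *)
Lemma normal_second_moment01 (R : realType) :
  (\int[lebesgue_measure]_x (x ^+ 2 * normal_pdf 0 1 x)%:E = 1 :> \bar R)%E.
Proof.
pose e2 (x : R) := expR (- (x ^+ 2 / 2)).
have me2 : measurable_fun setT e2.
  apply: measurableT_comp => //; apply: measurableT_comp => //.
  by apply: measurable_funM => //; exact: measurable_funX.
have e20 x : 0 <= e2 x by exact: expR_ge0.
pose k (x : R) := x ^+ 2 / 2 * e2 x.
have mk : measurable_fun setT k.
  by do 2 apply: measurable_funM => //; exact: measurable_funX.
have k0 x : 0 <= k x by rewrite mulr_ge0// mulr_ge0// sqr_ge0.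
pose B := (\int[lebesgue_measure]_x (k x)%:E)%E.
have B0 : (0 <= B)%E by apply: integral_ge0 => x _; rewrite lee_fin.
(* The scaling principle needs h > 0 on its domain; removing the origin costs only a null set. *)
pose D0 : set R := [set: R] `\ 0.
have setD0E (f : R -> R) : measurable_fun setT f -> (forall x, 0 <= f x) ->
    (\int[lebesgue_measure]_(x in D0) (f x)%:E =
     \int[lebesgue_measure]_x (f x)%:E)%E.
  move=> mf f0; rewrite [RHS](@ge0_negligible_integral _ _ R
    (@lebesgue_measure R) setT [set 0%R])//.
  - exact/measurable_EFinP.
  - by move=> x _; rewrite lee_fin.
  - exact: lebesgue_measure_set1.
have mX : measurable_fun [set: R] (fun x : R => x ^+ 2 / 2).
  by apply: measurable_funM => //; exact: measurable_funX.
have mkc (c : R) : measurable_fun setT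
    (fun x : R => 1 * (x ^+ 2 / 2) * expR (- (x ^+ 2 / 2 * c))).
  apply: measurable_funM; first exact: measurable_funM.
  apply: measurableT_comp => //.
  have mXc : measurable_fun [set: R] (fun x : R => x ^+ 2 / 2 * c).
    exact: measurable_funM.
  exact: measurableT_comp.
have BE : (\int[lebesgue_measure]_x (e2 x)%:E = B * 2%:E)%E.
  have := @integral_expRN_of_scaling _ _ _ (@lebesgue_measure R) D0
    (cst 1) (fun x : R => x ^+ 2 / 2) 2^-1 B.
  rewrite invrK => <- //.
  - under [RHS]eq_integral do rewrite mul1r.
    by rewrite setD0E.
  - exact: measurableD.
  - by move=> x; rewrite mulr_ge0// sqr_ge0.
  - by move=> x [_ /eqP x0]; rewrite divr_gt0// exprn_even_gt0.
  move=> c c1; have c0 := lt_le_trans ltr01 c1.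
  rewrite (setD0E
    (fun x => 1 * (x ^+ 2 / 2) * expR (- (x ^+ 2 / 2 * c)))); last 2 first.
  - exact: mkc.
  - by move=> x; rewrite mul1r mulr_ge0// ?expR_ge0// divr_ge0// sqr_ge0.
  (* Replacing x by sqrt(c) x turns h into c h. The Jacobian sqrt(c) and the factor c from h
     together give the required power c^(-3/2). *)
  pose s := Num.sqrt c; have s0 : 0 < s by rewrite sqrtr_gt0.
  have s2 : s ^+ 2 = c by rewrite sqr_sqrtr// ltW.
  have mkE : measurable_fun setT (EFin \o k) by exact/measurable_EFinP.
  rewrite /B (ge0_integral_affine 0 s0 mkE); last by move=> x; rewrite lee_fin.
  under [in RHS]eq_integral => x _.
    rewrite (_ : (EFin \o k) _ =
      (c%:E * (1 * (x ^+ 2 / 2) * expR (- (x ^+ 2 / 2 * c)))%:E)%E); last first.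
      rewrite /= /k /e2 addr0 exprMn s2 -EFinM; congr EFin.
      by rewrite (_ : c * x ^+ 2 / 2 = x ^+ 2 / 2 * c) ?mul1r; ring.
    over.
  rewrite ge0_integralZl//; last 3 first.
  - apply/measurable_EFinP; exact: mkc.
  - move=> x _; rewrite lee_fin mul1r mulr_ge0// ?expR_ge0//.
    by rewrite divr_ge0// sqr_ge0.
  - by rewrite lee_fin ltW.
  rewrite muleA -EFinM muleAC -EFinM; rewrite (_ : s * c * _ = 1) ?mul1e//.
  rewrite powRN powRD ?(gt_eqF c0) ?implybT// powRr1 ?ltW// powR12_sqrt ?ltW//.
  by rewrite -/s divff// mulf_neq0// gt_eqF.
(* The target 1 is replaced by the total mass of the normal density, which makes the value of the
   peak constant irrelevant. *)
rewrite -(@integral_normal_pdf R 0 1).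
under [RHS]eq_integral do rewrite normal_pdf01E EFinM.
rewrite ge0_integralZl//; last 2 first.
- exact/measurable_EFinP.
- by rewrite lee_fin normal_peak_ge0.
rewrite BE muleA muleAC -EFinM -ge0_integralZl//; last 3 first.
- exact/measurable_EFinP.
- by move=> x _; rewrite lee_fin.
- by rewrite lee_fin mulr_ge0// normal_peak_ge0.
apply: eq_integral => x _; rewrite -EFinM normal_pdf01E /k -/(e2 x).
by congr EFin; field.
Qed.

(** Complements the affine rule, which covers positive slopes only; it rests on the invariance of
    Lebesgue measure under reflection. *)
Lemma ge0_integral_opp (R : realType) (f : R -> \bar R) :
  measurable_fun setT f -> (forall x, (0 <= f x)%E) ->
  (\int[lebesgue_measure]_x f x = \int[lebesgue_measure]_x f (- x)%R)%E.
Proof.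
move=> mf f0.
have mN :
    measurable_fun [set: measurableTypeR R] (-%R : _ -> measurableTypeR R).
  exact: oppr_measurable.
rewrite (_ : (\int[lebesgue_measure]_x f (- x)%R)%E =
  \int[pushforward lebesgue_measure (-%R : _ -> measurableTypeR R)]_x f x)%E;
  last first.
  by rewrite (ge0_integral_pushforward mN).
by apply: eq_measure_integral => A mA _; rewrite /= lebesgue_measureN.
Qed.

(** After standardization, the symmetry of the normal law allows [s] to be replaced by [- s]. Adding
    the two versions keeps the integrands nonnegative, so the first moment, a signed integral, never
    has to be treated. *)
Lemma normal_second_moment (R : realType) (m s : R) : 0 < s ->
  (\int[lebesgue_measure]_x (x ^+ 2 * normal_pdf m s x)%:E =
   (m ^+ 2 + s ^+ 2)%:E)%E.
Proof.
move=> s0.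
pose n (x : R) := normal_pdf 0 1 x.
have mn : measurable_fun setT n by exact: measurable_normal_pdf.
have n0 x : 0 <= n x by exact: normal_pdf_ge0.
have sE x : s * normal_pdf m s (s * x + m) = n x.
  rewrite /n normal_pdf01E normal_pdfE ?gt_eqF// /normal_fun mulrA addrK.
  congr (_ * expR _).
    rewrite /normal_peak expr1n mul1r -mulrnAr sqrtrM ?sqr_ge0//.
    rewrite sqrtr_sqr gtr0_norm//.
    by rewrite invfM mulrA divff ?mul1r// gt_eqF.
  by rewrite exprMn -mulr_natr; field; rewrite gt_eqF.
have mX (f : R -> R) : measurable_fun setT f ->
    measurable_fun setT (fun x => (f x ^+ 2 * n x)%:E).
  move=> mf; apply/measurable_EFinP; apply: measurable_funM => //.
  exact: measurable_funX.
have X0 (f : R -> R) x : (0 <= (f x ^+ 2 * n x)%:E)%E.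
  by rewrite lee_fin mulr_ge0 ?sqr_ge0.
pose I (c : R) := (\int[lebesgue_measure]_x ((c * x + m) ^+ 2 * n x)%:E)%E.
have maff (c : R) : measurable_fun setT (fun x : R => c * x + m).
  by apply: measurable_funD => //; exact: measurable_funM.
have IE : (\int[lebesgue_measure]_x (x ^+ 2 * normal_pdf m s x)%:E = I s)%E.
  rewrite (ge0_integral_affine m s0); last 2 first.
  - apply/measurable_EFinP; apply: measurable_funM; first exact: measurable_funX.
    exact: measurable_normal_pdf.
  - by move=> x; rewrite lee_fin mulr_ge0 ?sqr_ge0 ?normal_pdf_ge0.
  rewrite -ge0_integralZl//; last 3 first.
  - apply/measurable_EFinP; apply: measurable_funM.
      by apply: measurable_funX; exact: maff.
    exact: (measurableT_comp (measurable_normal_pdf m s) (maff s)).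
  - by move=> x _; rewrite lee_fin mulr_ge0 ?sqr_ge0 ?normal_pdf_ge0.
  - by rewrite lee_fin ltW.
  by apply: eq_integral => x _; rewrite -EFinM -sE mulrCA.
have nN x : n (- x) = n x by rewrite /n !normal_pdf01E sqrrN.
have IN : I s = I (- s).
  rewrite /I (ge0_integral_opp (mX _ (maff s)) (X0 _)).
  by apply: eq_integral => x _; rewrite nN mulrN mulNr.
(* The cross term cancels between s and - s. *)
have I2 : (I s + I s = (2 * (m ^+ 2 + s ^+ 2))%:E)%E.
  rewrite {2}IN /I -ge0_integralD//;
    do ?[by move=> x _; exact: (X0 (fun x => _ * x + m)) |
         exact: (mX _ (maff _))].
  transitivity (\int[lebesgue_measure]_x ((2 * m ^+ 2)%:E * (n x)%:E +
    (2 * s ^+ 2)%:E * (x ^+ 2 * n x)%:E))%E.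
    apply: eq_integral => x _; rewrite -!EFinM -!EFinD; congr EFin; ring.
  have a0 (y : R) : 0 <= 2 * y ^+ 2 by rewrite mulr_ge0// sqr_ge0.
  have mn' : measurable_fun setT (fun x => (n x)%:E) by exact/measurable_EFinP.
  have mx' := mX id (@measurable_id _ _ _).
  have x0' : forall x, (0 <= (x ^+ 2 * n x)%:E)%E := X0 id.
  rewrite ge0_integralD//;
    do ?[by move=> x _; rewrite mule_ge0// lee_fin | exact: emeasurable_funM].
  rewrite !ge0_integralZl//; do ?[by rewrite lee_fin |
    by move=> x _; exact: x0' | by move=> x _; rewrite lee_fin].
  rewrite normal_second_moment01 integral_normal_pdf !mule1 -EFinD.
  by congr EFin; ring.
rewrite IE; move: I2; case: (I s) => [r| |]//.
by rewrite -EFinD => -[rE]; congr EFin; lra.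
Qed.

(** * Density of the noncentral t distribution *)

(** The joint density of the statistic and of W at the point (t, w); the square root outside the
    normal density is the Jacobian of t |-> t sqrt(w / nu) - lambda. *)
Definition t_kernel {R : realType} (nu lambda t w : R) : R :=
  chi2_pdf nu w *
  (Num.sqrt (w / nu) * normal_pdf 0 1 (t * Num.sqrt (w / nu) - lambda)).

Definition t_density {R : realType} (nu lambda t : R) : R :=
  \int[lebesgue_measure]_w t_kernel nu lambda t w.

(** The normalizing constant of the chi-square density together with the 1 / sqrt(nu) split off from
    sqrt(w / nu). *)
Definition t_cst {R : realType} (nu : R) : R :=
  (2 `^ (nu / 2) * Gamma (nu / 2) * Num.sqrt nu)^-1.

Section noncentral_t_density.
Context {R : realType}.
Variables nu lambda : R.
Hypothesis nu0 : 0 < nu.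
Notation mu := (@lebesgue_measure R).

(** The factor sqrt(w) raises the gamma shape from nu / 2 to (nu + 1) / 2; this is where the
    exponent of the final formula originates. *)
Lemma chi2_pdf_sqrtE w : chi2_pdf nu w * Num.sqrt (w / nu) =
  t_cst nu * ((fun x => x `^ ((nu + 1) / 2 - 1) * expR (- (x * 2^-1)))
                \_ `]0, +oo[) w.
Proof.
rewrite /chi2_pdf leNgt nu0/= !patchE.
case: ifPn => [/[!inE]|_]; last by rewrite !mul0r mulr0.
rewrite /= in_itv/= andbT => w0.
rewrite sqrtrM ?ltW// sqrtrV ?ltW// -(powR12_sqrt (ltW w0)) /t_cst /chi2_fun.
have -> : (nu + 1) / 2 - 1 = nu / 2 - 1 + 2^-1 by field.
rewrite (@powRD _ w (nu / 2 - 1) 2^-1); last by rewrite (gt_eqF w0) implybT.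
by rewrite !invfM; ring.
Qed.

Lemma measurable_t_kernel : measurable_fun setT
  (fun z : R * R => t_kernel nu lambda z.1 z.2).
Proof.
have ms : measurable_fun setT (fun z : R * R => Num.sqrt (z.2 / nu)).
  apply: measurableT_comp; last first.
    by apply: measurable_funM => //; exact: measurable_snd.
  by apply: continuous_measurable_fun; exact: sqrt_continuous.
apply: measurable_funM.
  by apply: measurableT_comp; [exact: measurable_chi2_pdf|exact: measurable_snd].
apply: measurable_funM => //; apply: measurableT_comp.
  exact: measurable_normal_pdf.
by apply: measurable_funB => //; apply: measurable_funM => //; exact: measurable_fst.
Qed.

Lemma measurable_t_kernel2 t : measurable_fun setT (t_kernel nu lambda t).
Proof.
exact: (measurableT_comp measurable_t_kernel (pair1_measurable t)).
Qed.

Lemma t_kernel_ge0 t w : 0 <= t_kernel nu lambda t w.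
Proof. by rewrite !mulr_ge0// ?chi2_pdf_ge0 ?sqrtr_ge0 ?normal_pdf_ge0. Qed.

(** The normal factor is bounded by its peak, which makes the bound independent of [t]. Up to
    constants it is a gamma integrand, hence integrable. *)
Let dom (w : R) : R := normal_peak 1 * (chi2_pdf nu w * Num.sqrt (w / nu)).

Lemma t_kernel_le t w : t_kernel nu lambda t w <= dom w.
Proof.
rewrite /t_kernel mulrA /dom mulrC ler_wpM2r//.
  by rewrite mulr_ge0 ?chi2_pdf_ge0 ?sqrtr_ge0.
by apply: normal_pdf_ub; exact: oner_neq0.
Qed.

Lemma t_cst_gt0 : 0 < t_cst nu.
Proof.
by rewrite invr_gt0 !mulr_gt0 ?powR_gt0 ?sqrtr_gt0 ?Gamma_gt0 ?divr_gt0.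
Qed.

Lemma ge0_integral_chi2_sqrt (f : R -> R) : measurable_fun setT f ->
  (forall w, 0 <= f w) ->
  (\int[mu]_w (chi2_pdf nu w * Num.sqrt (w / nu) * f w)%:E =
   (t_cst nu)%:E * \int[mu]_(w in `]0%R, +oo[)
     (w `^ ((nu + 1) / 2 - 1) * expR (- (w * 2^-1)) * f w)%:E)%E.
Proof.
move=> mf f0; rewrite [in RHS]integral_mkcond -ge0_integralZl//.
- apply: eq_integral => w _; rewrite chi2_pdf_sqrtE !patchE.
  case: ifPn => _; first by rewrite -EFinM !mulrA.
  by rewrite mulr0 mul0r; exact/esym/mule0.
- apply/(measurable_restrictT _ (measurable_itv _)); apply: measurable_funTS.
  apply/measurable_EFinP/measurable_funM => //.
  exact: measurable_powR_expRN.
- move=> w _; apply: erestrict_ge0 => x _.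
  by rewrite lee_fin !mulr_ge0 ?powR_ge0 ?expR_ge0.
- by rewrite lee_fin ltW// t_cst_gt0.
Qed.

Lemma integrable_dom : mu.-integrable setT (EFin \o dom).
Proof.
have d0 w : 0 <= dom w.
  by rewrite !mulr_ge0 ?normal_peak_ge0 ?chi2_pdf_ge0 ?sqrtr_ge0.
have ms : measurable_fun setT (fun w : R => chi2_pdf nu w * Num.sqrt (w / nu)).
  apply: measurable_funM; first exact: measurable_chi2_pdf.
  apply: measurableT_comp; last exact: measurable_funM.
  by apply: continuous_measurable_fun; exact: sqrt_continuous.
have md : measurable_fun setT dom by exact: measurable_funM.
apply/integrableP; split; first exact/measurable_EFinP.
under eq_integral do rewrite /= ger0_norm// /dom mulrC.

rewrite (@ge0_integral_chi2_sqrt (cst (normal_peak 1)))//; last first.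
  by move=> x; exact: normal_peak_ge0.
under eq_integral do rewrite mulrC EFinM/=.
rewrite ge0_integralZl//.
- rewrite integral_gamma_scaled ?divr_gt0 ?addr_gt0//.
  by rewrite -!EFinM ltry.
- apply/measurable_EFinP/measurable_funTS; exact: measurable_powR_expRN.
- by move=> w _; rewrite lee_fin mulr_ge0 ?powR_ge0 ?expR_ge0.
- by rewrite lee_fin normal_peak_ge0.
Qed.

Lemma integrable_t_kernel t : mu.-integrable setT (EFin \o t_kernel nu lambda t).
Proof.
apply: (le_integrable _ _ _ integrable_dom) => //.
  by apply/measurable_EFinP; exact: measurable_t_kernel2.
move=> w _; rewrite /= lee_fin !ger0_norm ?t_kernel_ge0 ?t_kernel_le//.
exact: le_trans (t_kernel_ge0 t w) (t_kernel_le t w).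
Qed.

Lemma EFin_t_density t : (t_density nu lambda t)%:E =
  (\int[mu]_w (t_kernel nu lambda t w)%:E)%E.
Proof.
rewrite /t_density /Rintegral fineK//.
by apply: integrable_fin_num => //; exact: integrable_t_kernel.
Qed.

Lemma t_density_ge0 t : 0 <= t_density nu lambda t.
Proof. by apply: Rintegral_ge0 => w _; exact: t_kernel_ge0. Qed.

Lemma continuous_t_density : continuous (t_density nu lambda).
Proof.
move=> t.
(* The window from t - 1 to t + 1 is arbitrary, because [dom] bounds the kernel for every [t]. *)
apply: (@continuity_under_integral _ _ _ mu (t_kernel nu lambda) setT measurableT
  (t - 1) (t + 1) _ _ dom integrable_dom).
- by move=> x _; exact: integrable_t_kernel.
- apply: aeW => w _ x _; pose a := Num.sqrt (w / nu).
  have cn : continuous (fun x : R => normal_pdf 0 1 (x * a - lambda)).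
    move=> y; apply: (@continuous_comp R R R (fun x => x * a - lambda)
      (normal_pdf 0 1)); last by apply: continuous_normal_pdf; exact: oner_neq0.
    apply: (@continuousB _ R^o R^o (fun x => x * a) (cst lambda)).
      by apply: (@continuousM _ R^o id (cst a)) => //; exact: cst_continuous.
    exact: cst_continuous.
  apply: (@continuousM _ R^o (cst (chi2_pdf nu w))
    (fun x => a * normal_pdf 0 1 (x * a - lambda))); first exact: cst_continuous.
  apply: (@continuousM _ R^o (cst a)); first exact: cst_continuous.
  exact: cn.
- move=> x _; apply: aeW => w _; rewrite ger0_norm ?t_kernel_ge0//.
  exact: t_kernel_le.
- by rewrite inE/= in_itv/=; lra.
Qed.

Lemma is_pdf_chi2 : is_pdf (chi2_prob nu) (chi2_pdf nu).
Proof.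
by split=> [|x|//]; [exact: measurable_chi2_pdf|exact: chi2_pdf_ge0].
Qed.

Lemma integral_normal_prob_indic (S : set R) : measurable S ->
  (\int[normal_prob 0 1]_z (\1_S z)%:E =
   \int[mu]_z (\1_S z * normal_pdf 0 1 z)%:E)%E.
Proof.
move=> mS; rewrite integral_indic// setIT [LHS]integral_mkcond.
apply: eq_integral => z _; rewrite patchE indicE.
by case: ifPn => _; rewrite ?mul1r ?mul0r.
Qed.

Lemma chi2_pdf_le0 w : w <= 0 -> chi2_pdf nu w = 0.
Proof.
move=> w0; rewrite /chi2_pdf leNgt nu0/= patchE ifF ?mul0r//.
by apply/negbTE; rewrite notin_setE/= in_itv/= andbT ltNge w0.
Qed.

(** For fixed w > 0 the substitution z = s t - lambda with s = sqrt(w / nu) inverts [t_stat], so the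
    indicator of the preimage becomes that of [A]; Tonelli then moves the integral over t to the
    outside. *)
Lemma is_pdf_t_density : is_pdf (t_dist nu lambda) (t_density nu lambda).
Proof.
split; [|exact: t_density_ge0|move=> A mA].
  by apply: continuous_measurable_fun; exact: continuous_t_density.
pose S := t_stat nu lambda @^-1` A.
have mS : measurable S.
  by rewrite -[X in measurable X]setTI; exact: measurable_t_stat.
have mSw w : measurable [set z | S (z, w)].
  rewrite -[X in measurable X]setTI.
  exact: (measurableT_comp (@measurable_t_stat R nu lambda)
    (pair2_measurable w)).
transitivity
    (\int[chi2_prob nu]_w \int[normal_prob 0 1]_z (\1_S (z, w))%:E)%E.
  rewrite -(@fubini_tonelli2 _ _ _ _ _ (normal_prob 0 1) (chi2_prob nu)
    (fun zw => (\1_S zw)%:E)).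
  - by rewrite integral_indic// setIT.
  - exact/measurable_EFinP/measurable_indic.
  - by move=> z; rewrite lee_fin.
rewrite (ge0_integral_is_pdf is_pdf_chi2); last 2 first.
- apply: (@measurable_fun_fubini_tonelli_G _ _ _ _ R (normal_prob 0 1)
    (fun zw => (\1_S zw)%:E)).
  + by apply/measurable_EFinP; exact: measurable_indic.
  + by move=> z; rewrite lee_fin.
- by move=> w; apply: integral_ge0 => z _; rewrite lee_fin.
pose f (z : R * R) : \bar R := (\1_A z.1 * t_kernel nu lambda z.1 z.2)%:E.
have mf : measurable_fun setT f.
  apply/measurable_EFinP/measurable_funM; last exact: measurable_t_kernel.
  by apply: measurableT_comp; [exact: measurable_indic|exact: measurable_fst].
have f0 z : (0 <= f z)%E by rewrite lee_fin mulr_ge0// t_kernel_ge0.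
transitivity (\int[mu]_w \int[mu]_t f (t, w))%E; last first.
  rewrite -(@fubini_tonelli _ _ _ _ R mu mu f mf f0) [RHS]integral_mkcond.
  apply: eq_integral => t _; rewrite patchE /f/= indicE.
  case: ifPn => _.
    by under eq_integral do rewrite mul1r; rewrite EFin_t_density.
  by under eq_integral do rewrite mul0r; rewrite integral0.
apply: eq_integral => w _.
(* For w <= 0 the square root is 0 and the substitution degenerates, but there the chi-square
   density vanishes. *)
have [w0|w0] := leP w 0.
  rewrite chi2_pdf_le0// mule0 integral0_eq// => t _.
  by rewrite /f /t_kernel chi2_pdf_le0// mul0r mulr0.
pose s := Num.sqrt (w / nu); have s0 : 0 < s by rewrite sqrtr_gt0 divr_gt0.
rewrite (_ : (fun z => (\1_S (z, w))%:E) =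
  (fun z => (\1_[set z | S (z, w)] z)%:E)); last first.
  by apply/funext => z; rewrite !indicE; congr (_%:R)%:E.
rewrite integral_normal_prob_indic//.
rewrite (ge0_integral_affine (- lambda) s0); last 2 first.
- apply/measurable_EFinP/measurable_funM; first exact: measurable_indic.
  exact: measurable_normal_pdf.
- by move=> z; rewrite lee_fin mulr_ge0// normal_pdf_ge0.
rewrite muleAC -EFinM -ge0_integralZl//.
- apply: eq_integral => t _; rewrite /f/= /t_kernel -/s -EFinM [t * s]mulrC.
  rewrite (_ : \1_[set z | S (z, w)] (s * t - lambda) = \1_A t).
    by congr EFin; ring.
  have E : t_stat nu lambda (s * t - lambda, w) = t.
    by rewrite /t_stat/= -/s subrK mulrAC divff ?mul1r// gt_eqF.
  rewrite !indicE; congr (nat_of_bool _)%:R.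
  by apply/idP/idP; rewrite !inE /S/= E.
- apply/measurable_EFinP.
  have ma : measurable_fun setT (fun x : R => s * x - lambda).
    by apply: measurable_funB => //; exact: measurable_funM.
  apply: measurable_funM.
    have mi : measurable_fun setT (\1_[set z | S (z, w)] : R -> R).
      exact: measurable_indic.
    exact: (measurableT_comp mi ma).
  exact: (measurableT_comp (measurable_normal_pdf 0 1) ma).
- by move=> z _; rewrite lee_fin mulr_ge0// normal_pdf_ge0.
- by rewrite lee_fin mulr_ge0 ?chi2_pdf_ge0// ltW.
Qed.

Lemma t_pdfE : t_pdf nu lambda = t_density nu lambda.
Proof.
by apply: t_pdf_eq; [exact: is_pdf_t_density|exact: continuous_t_density].
Qed.

End noncentral_t_density.

(** * Integration over the prior and the mixing variable *)

(** The term p x raises the shape from a to a + 1, and the integral of shape a + 1 is a / c times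
    that of shape a. *)
Lemma integral_gamma_affine (R : realType) (a c p : R) :
  0 < a -> 0 < c -> 0 <= p ->
  (\int[lebesgue_measure]_(x in `]0%R, +oo[)
    (x `^ (a - 1) * expR (- (x * c)) * (1 + p * x))%:E =
   (Gamma a * c `^ (- a) * (1 + p * a / c))%:E)%E.
Proof.
move=> a0 c0 p0; pose k b (x : R) := x `^ (b - 1) * expR (- (x * c)).
have mk b D : measurable_fun D (k b).
  by apply: measurable_funTS; exact: measurable_powR_expRN.
have k0 b x : 0 <= k b x by rewrite mulr_ge0 ?powR_ge0 ?expR_ge0.
have a10 : 0 < a + 1 by rewrite addr_gt0.
transitivity (\int[lebesgue_measure]_(x in `]0%R, +oo[)
    ((k a x)%:E + p%:E * (k (a + 1) x)%:E))%E.
  apply: eq_integral => x; rewrite inE/= in_itv/= andbT => x0.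
  rewrite -EFinM -EFinD; congr EFin; rewrite /k addrK.
  have -> : x `^ a = x `^ (a - 1) * x.
    rewrite -[in RHS](powRr1 (ltW x0)) powRr1 ?ltW// -{3}(powRr1 (ltW x0)).
    by rewrite -powRD ?subrK// (gt_eqF x0) implybT.
  by ring.
have mk' b D : measurable_fun D (EFin \o k b) by exact/measurable_EFinP.
have k0' b x : (0 <= (k b x)%:E)%E by rewrite lee_fin.
rewrite ge0_integralD//;
  do ?[by move=> x _; rewrite ?mule_ge0 | exact: mk' |
       by apply: emeasurable_funM => //; exact: mk'].
rewrite ge0_integralZl//; do ?[by move=> x _; exact: k0' | exact: mk'].
rewrite !integral_gamma_scaled// -EFinM -EFinD; congr EFin.
rewrite GammaD1// opprD powRD; last by rewrite (gt_eqF c0) implybT.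
by rewrite powR_inv1 ?ltW//; ring.
Qed.

(** Below, [m] and [s] are the posterior mean and standard deviation for a normal prior of variance
    tau^2 after one observation [u] of unit variance. [C] collects what does not depend on x; its
    factor s / tau^3 compares the normalization of the moment prior with that of the normal law of
    deviation [s]. *)
Lemma integral_normal_moment (R : realType) (tau u : R) : 0 < tau ->
  (\int[lebesgue_measure]_x
    (normal_pdf 0 1 (u - x) * normal_moment_pdf 0 tau x)%:E =
   (normal_peak 1 * (tau ^+ 2 + 1) `^ (- (3 / 2)) *
    expR (- (u ^+ 2 / (2 * (1 + tau ^+ 2)))) *
    (1 + u ^+ 2 * tau ^+ 2 / (1 + tau ^+ 2)))%:E)%E.
Proof.
move=> tau0; pose d := 1 + tau ^+ 2.
have d0 : 0 < d by rewrite addr_gt0// exprn_gt0.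
pose s := tau / Num.sqrt d; have sd0 : 0 < Num.sqrt d by rewrite sqrtr_gt0.
have s0 : 0 < s by rewrite divr_gt0.
have sd2 : Num.sqrt d ^+ 2 = d by rewrite sqr_sqrtr// ltW.
have s2 : s ^+ 2 = tau ^+ 2 / d by rewrite expr_div_n sd2.
pose m := u * s ^+ 2.
pose C := normal_peak 1 * expR (- (u ^+ 2 / (2 * d))) * (s / tau ^+ 3).
have C0 : 0 <= C.
  by rewrite !mulr_ge0 ?normal_peak_ge0 ?expR_ge0 ?invr_ge0 ?exprn_ge0// ltW.
have pi20 : 0 < Num.sqrt (2 * pi) :> R by rewrite sqrtr_gt0 mulr_gt0// pi_gt0.
transitivity (\int[lebesgue_measure]_x (C%:E * (x ^+ 2 * normal_pdf m s x)%:E))%E.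
  apply: eq_integral => x _; rewrite -EFinM; congr EFin.
  rewrite normal_pdf01E normal_pdfE ?gt_eqF// /normal_moment_pdf subr0.
  have -> : normal_peak s = (s * Num.sqrt (2 * pi))^-1.
    rewrite /normal_peak -mulrnAr sqrtrM ?sqr_ge0// sqrtr_sqr gtr0_norm//.
    by rewrite -[pi *+ 2]mulr_natl.
  rewrite /C /normal_fun -/d.
  (* Completing the square in x. *)
  have E : expR (- ((u - x) ^+ 2 / 2)) * expR (- (x ^+ 2 / (2 * tau ^+ 2))) =
      expR (- (u ^+ 2 / (2 * d))) * expR (- (x - m) ^+ 2 / (s ^+ 2 *+ 2)).
    rewrite -!expRD; congr expR; rewrite /m s2 /d -[_ *+ 2]mulr_natr.
    by field; rewrite !gt_eqF.
  rewrite [RHS](_ : _ = normal_peak 1 * x ^+ 2 / (tau ^+ 3 * Num.sqrt (2 * pi)) *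
    (expR (- (u ^+ 2 / (2 * d))) * expR (- (x - m) ^+ 2 / (s ^+ 2 *+ 2)))).
    by rewrite -E; field; rewrite !gt_eqF.
  by field; rewrite !gt_eqF.
rewrite ge0_integralZl//; last 2 first.
- apply/measurable_EFinP/measurable_funM; first exact: measurable_funX.
  exact: measurable_normal_pdf.
- by move=> x _; rewrite lee_fin mulr_ge0 ?sqr_ge0 ?normal_pdf_ge0.
rewrite normal_second_moment// -EFinM; congr EFin.
(* Since m = u s^2, the second moment is s^2 (1 + u^2 s^2). Its s^2 joins the s / tau^3 of [C] to
   form (s / tau)^3, where s / tau = (1 + tau^2)^(-1/2). *)
have -> : (tau ^+ 2 + 1) `^ (- (3 / 2)) = (s / tau) ^+ 3.
  rewrite /s mulrAC divff ?gt_eqF// mul1r addrC -/d.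
  rewrite (_ : (Num.sqrt d)^-1 = d `^ (- 2^-1)); last first.
    by rewrite powRN powR12_sqrt// ltW.
  by rewrite -powR_mulrn ?powR_ge0// -powRrM; congr (_ `^ _); field.
rewrite /C /m -/d.
transitivity (normal_peak 1 * expR (- (u ^+ 2 / (2 * d))) * (s / tau) ^+ 3 *
   (1 + u ^+ 2 * s ^+ 2)).
  by field; rewrite gt_eqF.
by rewrite s2; field; rewrite !gt_eqF.
Qed.

Lemma sqrM_sqrt_div (R : realType) (nu t w : R) : 0 < nu -> 0 < w ->
  (t * Num.sqrt (w / nu)) ^+ 2 = t ^+ 2 / nu * w.
Proof. by move=> nu0 w0; rewrite exprMn sqr_sqrtr ?divr_ge0 ?ltW//; ring. Qed.

(** One formula for both hypotheses: b = t^2 / nu and p = 0 under the null, b = t^2 / (nu (1 +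
    tau^2)) and p = tau^2 b under the alternative. The exponentials merge into the gamma rate (1 +
    b) / 2. The absolute value keeps the integrand nonnegative on the whole line. *)
Lemma integral_chi2_expRN (R : realType) (nu b p K : R) :
  0 < nu -> 0 <= b -> 0 <= p -> 0 <= K ->
  (\int[lebesgue_measure]_w (chi2_pdf nu w * Num.sqrt (w / nu) *
     (K * (expR (- (b * w / 2)) * (1 + p * `|w|))))%:E =
   (K * t_cst nu * Gamma ((nu + 1) / 2) * ((1 + b) / 2) `^ (- ((nu + 1) / 2)) *
     (1 + p * (nu + 1) / (1 + b)))%:E)%E.
Proof.
move=> nu0 b0 p0 K0; pose f (w : R) := expR (- (b * w / 2)) * (1 + p * `|w|).
have mf : measurable_fun setT f.
  apply: measurable_funM.
    have mb : measurable_fun setT (fun w : R => - (b * w / 2)).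
      by apply: measurableT_comp => //; do 2 apply: measurable_funM => //.
    exact: (measurableT_comp (@measurable_expR R) mb).
  by apply: measurable_funD => //; exact: measurable_funM.
have f0 w : 0 <= f w by rewrite mulr_ge0 ?expR_ge0// addr_ge0// mulr_ge0.
have mKf : measurable_fun setT (fun w => K * f w) by exact: measurable_funM.
rewrite (@ge0_integral_chi2_sqrt _ _ nu0 (fun w => K * f w) mKf); last first.
  by move=> w; exact: mulr_ge0.
have b10 : 0 < (1 + b) / 2 by rewrite divr_gt0// ltr_pwDl.
have a0 : 0 < (nu + 1) / 2 by rewrite divr_gt0// addr_gt0.
have -> : p * (nu + 1) / (1 + b) = p * ((nu + 1) / 2) / ((1 + b) / 2).
  by field; rewrite gt_eqF// ltr_pwDl.
set a := (nu + 1) / 2; set c := (1 + b) / 2.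
transitivity ((t_cst nu)%:E *
    (K%:E * (Gamma a * c `^ (- a) * (1 + p * a / c))%:E))%E; last first.
  by rewrite -!EFinM; congr EFin; ring.
congr (_ * _)%E; rewrite -integral_gamma_affine// -ge0_integralZl//.
- apply: eq_integral => w; rewrite inE/= in_itv/= andbT => w0.
  rewrite -EFinM; congr EFin; rewrite /f gtr0_norm//.
  have -> : expR (- (w * c)) = expR (- (w * 2^-1)) * expR (- (b * w / 2)).
    by rewrite -expRD; congr expR; rewrite /c; field.
  by ring.
- apply/measurable_EFinP/measurable_funTS/measurable_funM.
    exact: measurable_powR_expRN.
  by apply: measurable_funD => //; exact: measurable_funM.
- move=> w; rewrite /= in_itv/= andbT => w0.
  by rewrite lee_fin !mulr_ge0 ?powR_ge0 ?expR_ge0// addr_ge0// mulr_ge0// ltW.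
Qed.

Lemma t_density0E (R : realType) (nu t : R) : 0 < nu ->
  t_density nu 0 t = normal_peak 1 * t_cst nu * Gamma ((nu + 1) / 2) *
    ((1 + t ^+ 2 / nu) / 2) `^ (- ((nu + 1) / 2)).
Proof.
move=> nu0; apply: EFin_inj; rewrite EFin_t_density//.
have tn0 : 0 <= t ^+ 2 / nu by rewrite divr_ge0 ?sqr_ge0// ltW.
have := integral_chi2_expRN nu0 tn0 (lexx 0) (normal_peak_ge0 1).
rewrite !mul0r addr0 mulr1 => <-.
apply: eq_integral => w _; congr EFin; rewrite /t_kernel.
have [w0|w0] := leP w 0; first by rewrite chi2_pdf_le0// !mul0r.
by rewrite normal_pdf01E subr0 sqrM_sqrt_div// mul0r addr0 mulr1 !mulrA.
Qed.

(** Tonelli puts the prior integral inside; for w > 0 it is the normal moment integral at u = t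
    sqrt(w / nu), and u^2 is linear in w, so a gamma integral remains. *)
Lemma marginal_t_densityE (R : realType) (nu tau t : R) : 0 < nu -> 0 < tau ->
  marginal_pdf (t_density nu) (normal_moment_pdf 0 tau) t =
  normal_peak 1 * (tau ^+ 2 + 1) `^ (- (3 / 2)) * t_cst nu *
  Gamma ((nu + 1) / 2) *
  ((1 + t ^+ 2 / (nu * (1 + tau ^+ 2))) / 2) `^ (- ((nu + 1) / 2)) *
  (1 + t ^+ 2 * tau ^+ 2 / (nu * (1 + tau ^+ 2)) * (nu + 1) /
       (1 + t ^+ 2 / (nu * (1 + tau ^+ 2)))).
Proof.
move=> nu0 tau0; pose d := 1 + tau ^+ 2.
have d0 : 0 < d by rewrite addr_gt0// exprn_gt0.
have nd0 : 0 < nu * d by rewrite mulr_gt0.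
pose b := t ^+ 2 / (nu * d); pose p := t ^+ 2 * tau ^+ 2 / (nu * d).
have b0 : 0 <= b by rewrite divr_ge0 ?sqr_ge0// ltW.
have p0 : 0 <= p by rewrite divr_ge0 ?(ltW nd0)// mulr_ge0 ?sqr_ge0.
pose K : R := normal_peak 1 * (tau ^+ 2 + 1) `^ (- (3 / 2)).
have K0 : 0 <= K by rewrite mulr_ge0 ?normal_peak_ge0 ?powR_ge0.
apply: EFin_inj; rewrite -(integral_chi2_expRN nu0 b0 p0 K0).
pose j := normal_moment_pdf 0 tau.
have j0 x : 0 <= j x.
  rewrite mulr_ge0 ?expR_ge0// divr_ge0 ?sqr_ge0//.
  by rewrite mulr_ge0 ?sqrtr_ge0// exprn_ge0// ltW.
have mj : measurable_fun setT j.
  have mX : measurable_fun setT (fun x : R => (x - 0) ^+ 2).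
    by apply: measurable_funX; exact: measurable_funB.
  apply: measurable_funM; first exact: measurable_funM.
  have mN : measurable_fun setT (fun x : R => - ((x - 0) ^+ 2 / (2 * tau ^+ 2))).
    by apply: measurableT_comp => //; exact: measurable_funM.
  exact: (measurableT_comp (@measurable_expR R) mN).
pose f (z : R * R) : \bar R := (t_kernel nu z.1 t z.2 * j z.1)%:E.
have mf : measurable_fun setT f.
  have m1 : measurable_fun setT (fst : R * R -> R) by exact: measurable_fst.
  have m2 : measurable_fun setT (snd : R * R -> R) by exact: measurable_snd.
  have ms : measurable_fun setT (fun z : R * R => Num.sqrt (z.2 / nu)).
    apply: measurableT_comp; last exact: measurable_funM.
    by apply: continuous_measurable_fun; exact: sqrt_continuous.
  have mu : measurable_fun setT (fun z : R * R => t * Num.sqrt (z.2 / nu) - z.1).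
    by apply: measurable_funB => //; exact: measurable_funM.
  apply/measurable_EFinP/measurable_funM; last exact: (measurableT_comp mj m1).
  apply: measurable_funM; first exact: (measurableT_comp (measurable_chi2_pdf nu) m2).
  apply: measurable_funM => //.
  exact: (measurableT_comp (measurable_normal_pdf 0 1) mu).
have f0 z : (0 <= f z)%E by rewrite lee_fin mulr_ge0// t_kernel_ge0.
have lhsE : (\int[lebesgue_measure]_l (t_density nu l t * j l)%:E =
    \int[lebesgue_measure]_w (chi2_pdf nu w * Num.sqrt (w / nu) *
       (K * (expR (- (b * w / 2)) * (1 + p * `|w|))))%:E)%E.
  transitivity (\int[lebesgue_measure]_l \int[lebesgue_measure]_w f (l, w))%E.
    apply: eq_integral => l _; rewrite mulrC EFinM EFin_t_density// -ge0_integralZl//.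
    - by apply: eq_integral => w _; rewrite -EFinM mulrC.
    - by apply/measurable_EFinP; exact: measurable_t_kernel2.
    - by move=> w _; rewrite lee_fin t_kernel_ge0.
    - by rewrite lee_fin.
  rewrite (@fubini_tonelli _ _ _ _ R (@lebesgue_measure R)
    (@lebesgue_measure R) f mf f0).
  apply: eq_integral => w _.
  have [w0|w0] := leP w 0.
    rewrite chi2_pdf_le0// !mul0r integral0_eq// => l _.
    by rewrite /f /t_kernel/= chi2_pdf_le0// !mul0r.
  pose u := t * Num.sqrt (w / nu).
  transitivity ((chi2_pdf nu w * Num.sqrt (w / nu))%:E *
    \int[lebesgue_measure]_x (normal_pdf 0 1 (u - x) * j x)%:E)%E.
    rewrite -ge0_integralZl//.
    - by apply: eq_integral => l _; rewrite /f/t_kernel/= -EFinM !mulrA.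
    - apply/measurable_EFinP/measurable_funM => //.
      have mu : measurable_fun setT (fun x : R => u - x) by exact: measurable_funB.
      exact: (measurableT_comp (measurable_normal_pdf 0 1) mu).
    - by move=> x _; rewrite lee_fin mulr_ge0// normal_pdf_ge0.
    - by rewrite lee_fin mulr_ge0 ?chi2_pdf_ge0 ?sqrtr_ge0.
  rewrite integral_normal_moment// -EFinM; congr EFin; congr (_ * _).
  rewrite /u sqrM_sqrt_div// gtr0_norm// -/K -/d -[LHS]mulrA.
  congr (_ * (expR _ * _)).
    by rewrite /b; field; rewrite !gt_eqF.
  by rewrite /p; field; rewrite !gt_eqF.
(* The extended integral has been computed to a real number, so taking its finite part loses
   nothing. *)
by rewrite /marginal_pdf /Rintegral lhsE integral_chi2_expRN.
Qed.

Theorem theorem2 (R : realType) (tau nu : R) (tau_gt0 : 0 < tau)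
    (nu_gt0 : 0 < nu) (t : R) :
  let r := 1 + t ^+ 2 / nu in
  let s := 1 + t ^+ 2 / (nu * (1 + tau ^+ 2)) in
  let q := tau ^+ 2 * (nu + 1) / (nu * (1 + tau ^+ 2)) in
  bayes_factor (marginal_pdf (t_pdf nu) (normal_moment_pdf 0 tau)) (t_pdf nu 0) t =
  (tau ^+ 2 + 1) `^ (- (3 / 2)) * (r / s) `^ ((nu + 1) / 2) *
    (1 + q * t ^+ 2 / s).
Proof.
move=> r s q; rewrite /bayes_factor.
have -> : t_pdf nu = t_density nu by apply/funext => l; exact: t_pdfE.
rewrite marginal_t_densityE// t_density0E// -/r -/s.
have nd0 : 0 < nu * (1 + tau ^+ 2) by rewrite mulr_gt0// addr_gt0// exprn_gt0.
have r0 : 0 < r by rewrite ltr_pwDl// divr_ge0 ?sqr_ge0// ltW.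
have s0 : 0 < s by rewrite ltr_pwDl// divr_ge0 ?sqr_ge0// ltW.
set a := (nu + 1) / 2.
have a0 : 0 < a by rewrite divr_gt0// addr_gt0.
(* The halves match the gamma rates r / 2 and s / 2 of the two densities. *)
have -> : r / s = (r / 2) * (s / 2)^-1 by field; rewrite gt_eqF.
rewrite (@powRM _ (r / 2)) ?invr_ge0 ?divr_ge0 ?ltW//.
rewrite -[(s / 2)^-1]powR_inv1; last by rewrite divr_ge0 ?ltW.
rewrite -powRrM mulN1r [(r / 2) `^ (- a)]powRN.
have -> : 1 + q * t ^+ 2 / s =
    1 + t ^+ 2 * tau ^+ 2 / (nu * (1 + tau ^+ 2)) * (nu + 1) / s.
  by congr (1 + _ / _); rewrite /q; ring.
have r2 : 0 < (r / 2) `^ a by rewrite powR_gt0 ?divr_gt0.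
have pk : 0 < normal_peak 1 :> R by rewrite normal_peak_gt0 ?oner_neq0.
have ct := t_cst_gt0 nu_gt0; have G0 := Gamma_gt0 a0.
(* With the powers and constants turned into atoms, those in the denominator nonzero, the claim is
   an identity of fractions. *)
set e := 1 + _; set y := (s / 2) `^ _; set x := (_ + 1) `^ _.
move: r2 pk ct G0; set w := _ `^ a; set n := normal_peak 1; set k := t_cst nu.
set g := Gamma a; move=> w0 n0 k0 g0.
by field; rewrite !gt_eqF.
Qed.
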